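(* Let $(\mathfrak{g},\mathfrak{h},\phi)$ be a morphism Lie algebra over a field $\mathbf{k}$ of characteristic $0$ and let $(V,W,\psi)$ be a representation of it. Then there is a one-to-one correspondence between $\mathrm{Ext}(\phi,\psi)$ and the simple second cohomology group $H^2_{\mathsf{mLA},s}(\phi,\psi)$.
   Context: A morphism Lie algebra is a triple $(\mathfrak{g},\mathfrak{h},\phi)$ of two Lie algebras and a Lie algebra homomorphism $\phi:\mathfrak{g}\to\mathfrak{h}$. A homomorphism $(\mathfrak{g},\mathfrak{h},\phi)\to(\mathfrak{g}',\mathfrak{h}',\phi')$ is a pair $(\alpha,\beta)$ of Lie algebra homomorphisms $\alpha:\mathfrak{g}\to\mathfrak{g}'$, $\beta:\mathfrak{h}\to\mathfrak{h}'$ with $\phi'\circ\alpha=\beta\circ\phi$; it is an isomorphism if $\alpha,\beta$ both are. A representation of $(\mathfrak{g},\mathfrak{h},\phi)$ is a triple $(V,W,\psi)$ with $V$ a representation of $\mathfrak{g}$ (action $\rho_V$), $W$ a representation of $\mathfrak{h}$ (action $\rho_W$) and $\psi:V\to W$ linear with $\psi(\rho_V(x)v)=\rho_W(\phi(x))\psi(v)$. $W_\phi$ denotes $W$ as a representation of $\mathfrak{g}$ via $x\mapsto\rho_W(\phi(x))$. Cohomology. For a representation $(V,\rho)$ of a Lie algebra, the Chevalley–Eilenberg differential on $\mathrm{Hom}(\wedge^n\mathfrak{g},V)$ is $(\delta_{\mathsf{CE}}f)(x_1,\ldots,x_{n+1})=\sum_i(-1)^{i+1}\rho(x_i)f(\ldots,\widehat{x_i},\ldots)+\sum_{i<j}(-1)^{i+j}f([x_i,x_j],\ldots,\widehat{x_i},\ldots,\widehat{x_j},\ldots)$.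 Let $\delta'_{\mathsf{CE}},\delta''_{\mathsf{CE}},\delta'''_{\mathsf{CE}}$ be the differentials for $\mathfrak{g}$ with values in $V$, $\mathfrak{h}$ with values in $W$, and $\mathfrak{g}$ with values in $W_\phi$. For $n\ge1$, $C^n_{\mathsf{mLA}}(\phi,\psi)=\mathrm{Hom}(\wedge^n\mathfrak{g},V)\oplus\mathrm{Hom}(\wedge^n\mathfrak{h},W)\oplus\mathrm{Hom}(\wedge^{n-1}\mathfrak{g},W)$ and $\delta_{\mathsf{mLA}}(\theta,\gamma,\eta)=(\delta'_{\mathsf{CE}}\theta,\delta''_{\mathsf{CE}}\gamma,\psi\circ\theta-\gamma\circ\wedge^n\phi-\delta'''_{\mathsf{CE}}\eta)$. $Z^2_{\mathsf{mLA}}(\phi,\psi)$ is the space of $2$-cocycles, i.e. the kernel of $\delta_{\mathsf{mLA}}$ on $C^2_{\mathsf{mLA}}(\phi,\psi)$. A $2$-coboundary is simple if it is of the form $\delta_{\mathsf{mLA}}(d_0,\delta_0,0)$ for some $(d_0,\delta_0,0)\in C^1_{\mathsf{mLA}}(\phi,\psi)$; the space of simple $2$-coboundaries is $B^2_{\mathsf{mLA},s}(\phi,\psi)$, and $H^2_{\mathsf{mLA},s}(\phi,\psi)=Z^2_{\mathsf{mLA}}(\phi,\psi)/B^2_{\mathsf{mLA},s}(\phi,\psi)$. Extensions. Regard a triple $(V,W,\psi)$ of vector spaces and a linear map as a morphism Lie algebra with zero brackets. An abelian extension of $(\mathfrak{g},\mathfrak{h},\phi)$ by $(V,W,\psi)$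 is a short exact sequence of morphism Lie algebras, i.e. a morphism Lie algebra $(\widehat{\mathfrak{g}},\widehat{\mathfrak{h}},\widehat{\phi})$ with short exact sequences of Lie algebras $0\to V\xrightarrow{i}\widehat{\mathfrak{g}}\xrightarrow{p}\mathfrak{g}\to0$ and $0\to W\xrightarrow{\overline{i}}\widehat{\mathfrak{h}}\xrightarrow{\overline{p}}\mathfrak{h}\to0$ such that $\widehat{\phi}\circ i=\overline{i}\circ\psi$ and $\phi\circ p=\overline{p}\circ\widehat{\phi}$. Two abelian extensions $(\widehat{\mathfrak{g}},\widehat{\mathfrak{h}},\widehat{\phi})$ and $(\widehat{\mathfrak{g}}',\widehat{\mathfrak{h}}',\widehat{\phi}')$ are isomorphic if there is an isomorphism $(\alpha,\beta)$ of morphism Lie algebras between them that is compatible with the inclusions and projections, inducing the identity on $V,W,\mathfrak{g},\mathfrak{h}$ ($\alpha\circ i=i'$, $p'\circ\alpha=p$, $\beta\circ\overline{i}=\overline{i}'$, $\overline{p}'\circ\beta=\overline{p}$). A section is a pair of linear maps $s:\mathfrak{g}\to\widehat{\mathfrak{g}}$, $\overline{s}:\mathfrak{h}\to\widehat{\mathfrak{h}}$ with $p\circ s=\mathrm{id}_{\mathfrak{g}}$, $\overline{p}\circ\overline{s}=\mathrm{id}_{\mathfrak{h}}$. An abelian extension induces a representation of $(\mathfrak{g},\mathfrak{h},\phi)$ on $(V,W,\psi)$ by $\rho_V(x)v=[s(x),i(v)]_{\widehat{\mathfrak{g}}}$ and $\rho_W(h)w=[\overline{s}(h),\overline{i}(w)]_{\widehat{\mathfrak{h}}}$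 (viewed in $V$ and $W$ via $i$ and $\overline{i}$), independent of the section. For a fixed representation $(V,W,\psi)$, $\mathrm{Ext}(\phi,\psi)$ denotes the set of isomorphism classes of abelian extensions of $(\mathfrak{g},\mathfrak{h},\phi)$ by the triple $(V,W,\psi)$ whose induced representation is the prescribed one. *)

(* Defs.v *)
From HB Require Import structures.
From mathcomp Require Import all_boot all_order all_algebra.
From mathcomp Require Import all_classical.

Set Implicit Arguments.
Unset Strict Implicit.
Unset Printing Implicit Defensive.

Import GRing.Theory.
Local Open Scope ring_scope.
Local Open Scope classical_set_scope.

(* Lie algebras are not assumed to be finite dimensional. *)
HB.mixin Record isLieAlgebra (k : fieldType) L of GRing.Lmodule k L := {
  bracket : L -> L -> L;
  bracket_linearl : forall y, linear (fun x => bracket x y);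
  bracket_linearr : forall x, linear (bracket x);
  bracket_alt : forall x, bracket x x = 0;
  bracket_jacobi : forall x y z,
    bracket x (bracket y z) + bracket y (bracket z x)
      + bracket z (bracket x y) = 0 }.

#[short(type="lieAlgType")]
HB.structure Definition LieAlgebra (k : fieldType) :=
  {L of isLieAlgebra k L & GRing.Lmodule k L}.

Record lieHom (k : fieldType) (L M : lieAlgType k) := LieHom {
  lieHom_linear :> {linear L -> M};
  lieHomP : forall x y,
    lieHom_linear (bracket x y)
      = bracket (lieHom_linear x) (lieHom_linear y) }.

Definition zeroLie (V : Type) : Type := V.

Section ZeroLie.
Variables (k : fieldType) (V : lmodType k).

HB.instance Definition _ := GRing.Lmodule.on (zeroLie V).

Let zero_bracket (_ _ : zeroLie V) : zeroLie V := 0.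

Let zero_linearl y : linear (fun x => zero_bracket x y).
Proof. by move=> a u v; rewrite /zero_bracket scaler0 addr0. Qed.

Let zero_linearr x : linear (zero_bracket x).
Proof. by move=> a u v; rewrite /zero_bracket scaler0 addr0. Qed.

Let zero_jacobi x y z :
  zero_bracket x (zero_bracket y z) + zero_bracket y (zero_bracket z x)
    + zero_bracket z (zero_bracket x y) = 0.
Proof. by rewrite /zero_bracket !addr0. Qed.

HB.instance Definition _ := isLieAlgebra.Build k (zeroLie V)
  zero_linearl zero_linearr (fun=> erefl) zero_jacobi.

End ZeroLie.

Record morLie (k : fieldType) := MorLie {
  mdom : lieAlgType k;
  mcod : lieAlgType k;
  mmap : lieHom mdom mcod }.

Record morHom (k : fieldType) (G G' : morLie k) := MorHom {
  hdom : lieHom (mdom G) (mdom G');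
  hcod : lieHom (mcod G) (mcod G');
  morHomP : forall x, mmap G' (hdom x) = hcod (mmap G x) }.

Definition morIso (k : fieldType) (G G' : morLie k) (F : morHom G G') : Prop :=
  bijective (hdom F) /\ bijective (hcod F).

Section ZeroMor.
Variables (k : fieldType) (V W : lmodType k) (psi : {linear V -> W}).

Let zeroLie_linear : {linear zeroLie V -> zeroLie W} := psi.

Let zeroLie_bracket (u v : zeroLie V) :
  zeroLie_linear (bracket u v)
    = bracket (zeroLie_linear u) (zeroLie_linear v).
Proof. exact: raddf0. Qed.

Definition zeroMor : morLie k :=
  @MorLie k (zeroLie V) (zeroLie W) (LieHom zeroLie_bracket).

End ZeroMor.

Record lieRep (k : fieldType) (L : lieAlgType k) := LieRep {
  rep_space :> lmodType k;
  act : L -> rep_space -> rep_space;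
  act_linearl : forall v, linear (fun x => act x v);
  act_linearr : forall x, linear (act x);
  act_bracket : forall x y v,
    act (bracket x y) v = act x (act y v) - act y (act x v) }.

Section PullbackRep.
Variables (k : fieldType) (L M : lieAlgType k) (phi : lieHom L M).
Variable W : lieRep M.

Let pull_act (x : L) (w : W) : W := act (phi x) w.

Let pull_linearl w : linear (fun x => pull_act x w).
Proof. by move=> a u v; rewrite /pull_act linearP act_linearl. Qed.

Let pull_linearr x : linear (pull_act x).
Proof. exact: act_linearr. Qed.

Let pull_bracket x y w :
  pull_act (bracket x y) w
    = pull_act x (pull_act y w) - pull_act y (pull_act x w).
Proof. by rewrite /pull_act lieHomP act_bracket. Qed.

Definition pullRep : lieRep L := LieRep pull_linearl pull_linearr pull_bracket.

End PullbackRep.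

Record morRep (k : fieldType) (G : morLie k) := MorRep {
  rdom : lieRep (mdom G);
  rcod : lieRep (mcod G);
  rmap : {linear rdom -> rcod};
  morRepP : forall x v, rmap (act x v) = act (mmap G x) (rmap v) }.

(* [alternating f] says that f : L^n -> V is multilinear and alternating,     *)
(* i.e. that f is an element of Hom (/\^n L, V).                              *)
Definition alternating (k : fieldType) (L V : lmodType k) (n : nat)
    (f : ('I_n -> L) -> V) : Prop :=
  (forall (x : 'I_n -> L) (i : 'I_n),
     linear (fun u : L => f [eta x with i |-> u])) /\
  (forall (x : 'I_n -> L) (i j : 'I_n), i != j -> x i = x j -> f x = 0).

(* The arguments ([x_i, x_j], x_0, .., x_n without x_i and x_j), for i < j.   *)
(* Counting from 0, the m-th number other than i and j is bump j (bump i m).  *)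
Definition bracket_args (k : fieldType) (L : lieAlgType k) (n : nat)
    (x : 'I_n.+1 -> L) (i j : 'I_n.+1) : 'I_n -> L :=
  fun l => if val l is m.+1 then x (inord (bump j (bump i m)))
           else bracket (x i) (x j).

(* The Chevalley-Eilenberg differential. The arguments are numbered from 0,   *)
(* so that the signs (-1)^(i+1) and (-1)^(i+j) for arguments numbered from 1  *)
(* become (-1)^i and (-1)^(i+j). It is defined on all functions L^n -> V      *)
(* and used on the alternating ones only.                                     *)
Definition ce_diff (k : fieldType) (L : lieAlgType k) (V : lieRep L) (n : nat)
    (f : ('I_n -> L) -> V) : ('I_n.+1 -> L) -> V :=
  fun x =>
    \sum_(i < n.+1) (-1) ^+ i *: act (x i) (f (x \o lift i))
    + \sum_(i < n.+1) \sum_(j < n.+1 | (i < j)%N)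
        (-1) ^+ (i + j) *: f (bracket_args x i j).

Section Linearity.
Variables (k : fieldType) (n : nat).

Section Alternating.
Variables L V : lmodType k.

Lemma alternating_comb (a : k) (f g : ('I_n -> L) -> V) :
  alternating f -> alternating g -> alternating (a *: f + g).
Proof.
move=> [lf af] [lg ag]; split=> [x i c u v | x i j ij xij] /=.
  rewrite !fctE lf lg !scalerDr !scalerA (mulrC a c).
  by rewrite -!addrA; congr (_ + _); rewrite addrCA.
by rewrite !fctE (af x i j) // (ag x i j) // scaler0 addr0.
Qed.

Lemma alternating0 : alternating (0 : ('I_n -> L) -> V).
Proof.
by split=> // x i a u v; change (0 = a *: 0 + 0 :> V); rewrite scaler0 addr0.
Qed.

End Alternating.

Lemma ce_diff_linear (L : lieAlgType k) (V : lieRep L) :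
  linear (@ce_diff k L V n : (('I_n -> L) -> V) -> ('I_n.+1 -> L) -> V).
Proof.
move=> a f g; apply/funext => x; rewrite /ce_diff !fctE scalerDr addrACA.
congr (_ + _); rewrite scaler_sumr -big_split /=; apply: eq_bigr => i _.
  by rewrite act_linearr scalerDr !scalerA mulrC.
rewrite scaler_sumr -big_split /=; apply: eq_bigr => j _.
by rewrite scalerDr !scalerA mulrC.
Qed.

End Linearity.

Section Cohomology.
Variables (k : fieldType) (G : morLie k) (R : morRep G).

(* The index m stands for degree m + 1, since the complex starts in degree 1. *)
Definition precochain (m : nat) : lmodType k :=
  ((('I_m.+1 -> mdom G) -> rdom R) * (('I_m.+1 -> mcod G) -> rcod R)
   * (('I_m -> mdom G) -> rcod R))%type.

Definition cochain (m : nat) : set (precochain m) :=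
  [set c | [/\ alternating c.1.1, alternating c.1.2 & alternating c.2]].

Definition mLA_diff (m : nat) (c : precochain m) : precochain m.+1 :=
  (ce_diff c.1.1,
   ce_diff c.1.2,
   fun x => rmap R (c.1.1 x) - c.1.2 (mmap G \o x)
            - @ce_diff k (mdom G) (pullRep (mmap G) (rcod R)) m c.2 x).

Definition cocycle (m : nat) : {pred precochain m} :=
  fun c => `[< cochain c /\ mLA_diff c = 0 >].

Lemma mLA_diff_linear (m : nat) : linear (@mLA_diff m).
Proof.
move=> a [[t1 g1] e1] [[t2 g2] e2].
apply: (congr2 pair (congr2 pair (ce_diff_linear (V := rdom R) a t1 t2)
  (ce_diff_linear (V := rcod R) a g1 g2))).
apply/funext => x /=.
rewrite (ce_diff_linear (V := pullRep (mmap G) (rcod R)) a e1 e2).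
rewrite !fctE linearP !scalerBr !opprD -!addrA; congr (_ + _).
rewrite addrCA; congr (_ + _).
rewrite [RHS]addrCA; congr (_ + _).
exact: addrCA.
Qed.

Lemma cocycle_submod (m : nat) : submod_closed (@cocycle m).
Proof.
split=> [|a c d /asboolP[[c1 c2 c3] c0] /asboolP[[d1 d2 d3] d0]].
  apply/asboolP; split; first by split; apply: alternating0.
  have := mLA_diff_linear (-1) (0 : precochain m) 0.
  by rewrite scaleN1r addNr scaleN1r addNr.
apply/asboolP; split.
  by split; apply: alternating_comb.
by rewrite mLA_diff_linear c0 d0 scaler0 addr0.
Qed.

HB.instance Definition _ (m : nat) :=
  GRing.isSubmodClosed.Build k (precochain m) (@cocycle m)
    (@cocycle_submod m).

Record cocycle2 := Cocycle2 {
  cocycle2_val :> precochain 1;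
  cocycle2P : cocycle2_val \in @cocycle 1 }.

HB.instance Definition _ := [isSub for cocycle2_val].
HB.instance Definition _ := [Choice of cocycle2 by <:].
HB.instance Definition _ := [SubChoice_isSubLmodule of cocycle2 by <:].

(* A predicate on cocycles: simple 2-coboundaries are cocycles, as delta_mLA  *)
(* squares to zero.                                                           *)
Definition simple_coboundary2 : {pred cocycle2} :=
  fun z => `[< exists d0 delta0,
    @cochain 0 (d0, delta0, 0) /\ mLA_diff (d0, delta0, 0) = z :> precochain 1 >].

Lemma simple_coboundary2_zmod : zmod_closed simple_coboundary2.
Proof.
split=> [|z1 z2 /asboolP[t1 [g1 [[/= at1 ag1 ae1] e1]]]].
  apply/asboolP; exists 0, 0; split; first by split; apply: alternating0.
  have := mLA_diff_linear (-1) (0 : precochain 0) 0.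
  by rewrite scaleN1r addNr scaleN1r addNr.
move=> /asboolP[t2 [g2 [[/= at2 ag2 ae2] e2]]].
apply/asboolP; exists (t1 - t2), (g1 - g2).
have lin (n : nat) (L U : lmodType k) (f g : ('I_n -> L) -> U) :
  alternating f -> alternating g -> alternating (f - g).
  by move=> af ag; rewrite addrC -scaleN1r; apply: alternating_comb.
split; first by split; [exact: lin | exact: lin | exact: alternating0].
have -> : cocycle2_val (z1 - z2) = cocycle2_val z1 - cocycle2_val z2 :=
  raddfB (val : cocycle2 -> _) z1 z2.
rewrite -e1 -e2 [RHS]addrC -[- mLA_diff _]scaleN1r.
apply: etrans (mLA_diff_linear (-1) ((t2, g2, 0) : precochain 0) (t1, g1, 0)).
congr mLA_diff; congr (_, _, _) => /=.
- by rewrite scaleN1r addrC.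
- by rewrite scaleN1r addrC.
- by rewrite scaler0 addr0.
Qed.

HB.instance Definition _ :=
  GRing.isZmodClosed.Build cocycle2 simple_coboundary2 simple_coboundary2_zmod.

(* H^2_(mLA,s), as a quotient of additive groups *)
Definition simpleH2 : zmodType := Quotient.quot simple_coboundary2.

End Cohomology.

Definition short_exact (k : fieldType) (A B C : lieAlgType k)
    (i : lieHom A B) (p : lieHom B C) : Prop :=
  [/\ injective i, range p = setT & range i = p @^-1` [set 0]].

Section Extensions.
Variables (k : fieldType) (G : morLie k).

(* Abelian extensions of G by the triple (V, W, psi) of two vector spaces and *)
(* a linear map.                                                              *)
Record abExt (V W : lmodType k) (psi : {linear V -> W}) := AbExt {
  ext_mor :> morLie k;
  ext_incl : morHom (zeroMor psi) ext_mor;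
  ext_proj : morHom ext_mor G;
  ext_exact_dom : short_exact (hdom ext_incl) (hdom ext_proj);
  ext_exact_cod : short_exact (hcod ext_incl) (hcod ext_proj) }.

Definition abExt_iso (V W : lmodType k) (psi : {linear V -> W})
    (E E' : abExt psi) : Prop :=
  exists2 F : morHom E E', morIso F &
    [/\ forall v, hdom F (hdom (ext_incl E) v) = hdom (ext_incl E') v,
        forall x, hdom (ext_proj E') (hdom F x) = hdom (ext_proj E) x,
        forall w, hcod F (hcod (ext_incl E) w) = hcod (ext_incl E') w &
        forall y, hcod (ext_proj E') (hcod F y) = hcod (ext_proj E) y].

Record abExt_section (V W : lmodType k) (psi : {linear V -> W})
    (E : abExt psi) := AbExtSection {
  sec_dom : {linear mdom G -> mdom E};
  sec_cod : {linear mcod G -> mcod E};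
  sec_domK : cancel sec_dom (hdom (ext_proj E));
  sec_codK : cancel sec_cod (hcod (ext_proj E)) }.

(* The representation induced by E on (V, W, psi) is R. The induced           *)
(* representation does not depend on the section, and sections exist for all  *)
(* extensions, so that one may equally well ask for this for some section.    *)
Definition induced_rep (R : morRep G) (E : abExt (rmap R)) : Prop :=
  forall s : abExt_section E,
    (forall x v, hdom (ext_incl E) (act x v)
                 = bracket (sec_dom s x) (hdom (ext_incl E) v)) /\
    (forall y w, hcod (ext_incl E) (act y w)
                 = bracket (sec_cod s y) (hcod (ext_incl E) w)).

(* An isomorphism class of extensions is a predicate on extensions. It is not *)
(* a classical set, because the universe of set is too small for abExt.       *)
Definition abExt_class (R : morRep G) (E E' : abExt (rmap R)) : Prop :=
  induced_rep E' /\ abExt_iso E E'.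

Record Ext (R : morRep G) := MkExt {
  in_class : abExt (rmap R) -> Prop;
  in_classP : exists2 E, induced_rep E & in_class = abExt_class E }.

Lemma Ext_eq (R : morRep G) (C C' : Ext R) :
  in_class C = in_class C' -> C = C'.
Proof.
case: C C' => [c cP] [c' cP'] /= cc'; case: _ / cc' in cP' *.
by rewrite (Prop_irrelevance cP cP').
Qed.

End Extensions.

(* Main.v *)
(* A 2-cocycle (theta, gamma, eta) gives an extension on V * g and W * h: the *)
(* brackets are those of the semidirect products twisted by theta and gamma,  *)
(* and the structure map is (v, x) |-> (psi v + eta x, phi x). Conversely,    *)
(* linear sections s, t of an extension with structure map Phi give           *)
(*   theta (x, y) = [s x, s y] - s [x, y],                                    *)
(*   gamma (x, y) = [t x, t y] - t [x, y],                                    *)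
(*   eta x = Phi (s x) - t (phi x),                                           *)
(* and (v, x) |-> v + s x identifies the twisted product with the extension.  *)
(* An isomorphism between two twisted products is (v, x) |-> (v + d x, x) on  *)
(* the first component and (w, y) |-> (w + e y, y) on the second; it exists   *)
(* exactly when the cocycles differ by the simple coboundary of (d, e, 0).    *)

From HB Require Import structures.
Require Import Defs.
From mathcomp Require Import all_boot all_order all_algebra.
From mathcomp Require Import all_classical.
Import GRing.Theory.
Local Open Scope ring_scope.
Local Open Scope classical_set_scope.

Set Implicit Arguments.
Unset Strict Implicit.
Unset Printing Implicit Defensive.

(** The bijection is induced by sending a cocycle [c] to the class of its twisted extension
    [cocycle_ext c]. Every class is reached: linear sections exist in any dimension ([split_epi]),
    and the failure of a pair of sections to respect brackets and structure maps is a triple whose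
    cocycle equations express the Jacobi identities of the two total algebras and the
    multiplicativity of the structure map ([section_cocycle], [cocycle_ext_surj]).

    The fibres are the cosets of the simple coboundaries: an isomorphism inducing the identity on
    kernels and quotients is a shear, given by linear maps [d] and [e]. Preserving the two brackets
    and commuting with the structure maps are the three components of the equation saying that
    [c - c'] is the coboundary of [(d, e, 0)] ([cocycle_ext_isoP], [simple_coboundary2P]). A shear
    has no parameter in Hom of the zeroth exterior power of g into W, whence the zero third entry
    and the word simple. *)

Lemma addNl_eq0 (V : zmodType) (x t : V) : t = x -> - x + t = 0.
Proof. by move=> ->; rewrite addNr. Qed.

Lemma addl_eq (V : zmodType) (x t : V) : t = 0 -> x + t = x.
Proof. by move=> ->; rewrite addr0. Qed.

Ltac zmod_pull_opp x :=
  first [ refine (@addNl_eq0 _ x _ _)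
        | rewrite (addrCA _ (- x)); zmod_pull_opp x ].

Ltac zmod_pull x :=
  first [ refine (@addl_eq _ x _ _) | rewrite (addrCA _ x); zmod_pull x ].

(* Decides identities between sums of atoms with signs in an abelian group:   *)
(* everything is put on the left hand side, and each summand [- x] is moved   *)
(* to the front and cancelled against a summand [x].                          *)
Ltac zmod_cancel :=
  apply/eqP; rewrite -subr_eq0; apply/eqP;
  match goal with |- ?t = 0 => rewrite -[t]addr0 end;
  rewrite ?opprD ?opprK ?oppr0 -?addrA ?add0r;
  repeat match goal with
  | |- context [- ?x] => zmod_pull_opp x; zmod_pull x
  end; rewrite ?(addr0, add0r); done.

(** * Linear maps and linear sections of surjections *)

Section Linear.
Variables (k : fieldType) (U V : lmodType k).

Definition mkLinear (f : U -> V) (lf : linear f) : {linear U -> V} :=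
  HB.pack f (GRing.isLinear.Build k U V _ f lf).

Variables (f : U -> V) (lf : linear f).

Lemma linear_add u v : f (u + v) = f u + f v.
Proof. exact: (linearD (mkLinear lf)). Qed.

Lemma linear_opp u : f (- u) = - f u.
Proof. exact: (linearN (mkLinear lf)). Qed.

Lemma linear_zero : f 0 = 0.
Proof. exact: (linear0 (mkLinear lf)). Qed.

End Linear.

Section SplitEpi.
Variables (k : fieldType) (E L : lmodType k) (p : {linear E -> L}).

(* Zorn's lemma is applied to these sets: a maximal one is a complement of    *)
(* the kernel of p. The empty set, union of the empty chain, is one of them.   *)
Let independent (A : set E) : Prop :=
  (forall a u v, A u -> A v -> A (a *: u + v)) /\
  (forall u, A u -> p u = 0 -> u = 0).

Let independent_bigcup (F : set (set E)) :
  F `<=` independent -> total_on F subset -> independent (\bigcup_(X in F) X).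
Proof.
move=> Find Ftot; split=> [a u v [X FX Xu] [Y FY Yv] | u [X FX Xu]].
  have [XY|YX] := Ftot _ _ FX FY.
    by exists Y => //; apply: (Find _ FY).1 => //; apply: XY.
  by exists X => //; apply: (Find _ FX).1 => //; apply: YX.
exact: (Find _ FX).2.
Qed.

(** The restriction of [p] to a maximal independent set [A] is a linear bijection onto [L]; its
    inverse is the section. *)
Lemma split_epi : range p = setT -> exists s : {linear L -> E}, cancel s p.
Proof.
move=> surj.
have [A [[linA indA] maxA]] := Zorn_bigcup independent_bigcup.
(* If 0 were missing, closure under combinations would make [A] empty, hence strictly smaller than
   [[set 0]]. *)
have A0 : A 0.
  apply: contrapT => nA0; apply: (maxA [set 0]).
    split=> [u Au | sub]; last by apply: nA0; apply: sub.
    by case: nA0; rewrite -(addNr u) -scaleN1r; apply: linA.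
  split=> [a u v -> -> | u -> //]; first by rewrite scaler0 addr0.
have AZ a u : A u -> A (a *: u).
  by move=> Au; rewrite -[_ *: _]addr0; apply: linA.
have AB u v : A u -> A v -> A (u - v).
  by move=> Au Av; rewrite addrC -scaleN1r; apply: linA.
have lift (x : L) : exists u, A u /\ p u = x.
  have [e _ <-] : range p x by rewrite surj.
  apply: contrapT => nlift.
  (* If no element of [A] lies over [x = p e], adjoining the line through [e] keeps independence and
     contradicts maximality. *)
  pose B := [set v | exists a u, A u /\ v = a *: e + u].
  apply: (maxA B).
    split=> [u Au|sub]; first by exists 0, u; rewrite scale0r add0r.
    apply: nlift; exists e; split=> //; apply: sub.
    by exists 1, 0; rewrite scale1r addr0.
  split=> [a _ _ [b [u [Au ->]]] [c [v [Av ->]]] | _ [a [u [Au ->]]]].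
    exists (a * b + c), (a *: u + v); split; first exact: linA.
    by rewrite scalerDr scalerA scalerDl addrACA.
  have [-> | a0] := eqVneq a 0.
    by rewrite scale0r add0r; apply: indA.
  rewrite linearD linearZ /= => /eqP; rewrite addr_eq0 => /eqP pe.
  case: nlift; exists ((- a^-1) *: u); split; first exact: AZ.
  by rewrite linearZ /= scaleNr -scalerN -pe scalerA mulVf // scale1r.
have /choice [s sP] := lift.
have uniq u v : A u -> A v -> p u = p v -> u = v.
  move=> Au Av puv; apply/eqP; rewrite -subr_eq0; apply/eqP.
  by apply: indA; [exact: AB | rewrite linearB puv subrr].
have ls : linear s.
  move=> a x y; apply: uniq; [exact: (sP _).1 | | ].
    by apply: linA; apply: (sP _).1.
  by rewrite linearP !(sP _).2.
by exists (mkLinear ls) => x; apply: (sP x).2.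
Qed.

End SplitEpi.

(** * Brackets, actions and cochains in low degree *)

Section LieTheory.
Variables (k : fieldType) (L : lieAlgType k).
Implicit Types x y z : L.

Lemma bracketDl x y z : bracket (x + y) z = bracket x z + bracket y z.
Proof. exact: (linear_add (bracket_linearl z)). Qed.

Lemma bracketDr x y z : bracket x (y + z) = bracket x y + bracket x z.
Proof. exact: (linear_add (bracket_linearr x)). Qed.

Lemma bracketNl x y : bracket (- x) y = - bracket x y.
Proof. exact: (linear_opp (bracket_linearl y)). Qed.

Lemma bracketNr x y : bracket x (- y) = - bracket x y.
Proof. exact: (linear_opp (bracket_linearr x)). Qed.

Lemma bracketC x y : bracket x y = - bracket y x.
Proof.
apply/eqP; rewrite -addr_eq0; apply/eqP.
have := bracket_alt (x + y).
by rewrite bracketDl !bracketDr !bracket_alt add0r addr0.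
Qed.

Variable V : lieRep L.
Implicit Types u v : V.

Lemma actDr x u v : act x (u + v) = act x u + act x v.
Proof. exact: (linear_add (act_linearr x)). Qed.

Lemma actNr x v : act x (- v) = - act x v.
Proof. exact: (linear_opp (act_linearr x)). Qed.

Lemma act0r x : act x 0 = 0 :> V.
Proof. exact: (linear_zero (act_linearr x)). Qed.

End LieTheory.

Section SmallCochains.
Variable k : fieldType.

Definition pair2 (T : Type) (x y : T) : 'I_2 -> T :=
  fun i => if val i is 0%N then x else y.

Lemma pair2E (T : Type) (x : 'I_2 -> T) : pair2 (x ord0) (x ord_max) = x.
Proof.
apply/funext => -[[|[|//]] /= lt_i]; rewrite /pair2 /=;
  by congr (x _); apply: val_inj.
Qed.

Lemma fun1E (T : Type) (x : 'I_1 -> T) : (fun=> x ord0) = x.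
Proof. by apply/funext => i; rewrite (ord1 i). Qed.

Section Alternating.
Variables L V : lmodType k.

Lemma linear_alternating1 (g : L -> V) (lg : linear g) :
  alternating (fun x : 'I_1 -> L => g (x ord0)).
Proof.
split=> [x i a u v | x i j]; last by rewrite (ord1 i) (ord1 j) eqxx.
by rewrite (ord1 i) /= lg.
Qed.

Lemma alternating1_linear (f : ('I_1 -> L) -> V) :
  alternating f -> linear (fun x => f (fun=> x)).
Proof.
move=> [lf _] a u v.
have E x : (fun=> x) = [eta (fun=> 0 : L) with ord0 |-> x] :> ('I_1 -> L).
  by apply/funext => i; rewrite (ord1 i).
by rewrite (E (a *: u + v)) (E u) (E v) lf.
Qed.

Lemma bilinear_alternating2 (g : L -> L -> V) (lgl : forall y, linear (g^~ y))
  (lgr : forall x, linear (g x)) (g_alt : forall x, g x x = 0) :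
  alternating (fun x : 'I_2 -> L => g (x ord0) (x ord_max)).
Proof.
split=> [x i a u v | x i j nij xij].
  case: i => [[|[|//]] lt_i].
    exact: (lgl (x ord_max)).
  exact: (lgr (x ord0)).
suff -> : x ord0 = x ord_max by [].
have E0 (lt0 : (0 < 2)%N) : Ordinal lt0 = ord0 by apply: val_inj.
have E1 (lt1 : (1 < 2)%N) : Ordinal lt1 = ord_max by apply: val_inj.
case: i j nij xij => [[|[|//]] lt_i] [[|[|//]] lt_j] //;
  by rewrite E0 E1.
Qed.

Variables (f : ('I_2 -> L) -> V) (altf : alternating f).

Lemma alternating2_linearl y : linear (fun x => f (pair2 x y)).
Proof.
move=> a u v.
have E x : pair2 x y = [eta pair2 0 y with ord0 |-> x].
  by apply/funext => -[[|[|//]] lt_i].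
by rewrite (E (a *: u + v)) (E u) (E v) altf.1.
Qed.

Lemma alternating2_linearr x : linear (fun y => f (pair2 x y)).
Proof.
move=> a u v.
have E y : pair2 x y = [eta pair2 x 0 with ord_max |-> y].
  by apply/funext => -[[|[|//]] lt_i].
by rewrite (E (a *: u + v)) (E u) (E v) altf.1.
Qed.

Lemma alternating2Dl x y z :
  f (pair2 (x + y) z) = f (pair2 x z) + f (pair2 y z).
Proof. exact: (linear_add (alternating2_linearl z)). Qed.

Lemma alternating2Dr x y z :
  f (pair2 x (y + z)) = f (pair2 x y) + f (pair2 x z).
Proof. exact: (linear_add (alternating2_linearr x)). Qed.

Lemma alternating2_alt x : f (pair2 x x) = 0.
Proof. exact: (altf.2 _ ord0 ord_max). Qed.

Lemma alternating2Nl x y : f (pair2 (- x) y) = - f (pair2 x y).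
Proof. exact: (linear_opp (alternating2_linearl y)). Qed.

Lemma alternating20r x : f (pair2 x 0) = 0.
Proof. exact: (linear_zero (alternating2_linearr x)). Qed.

Lemma alternating2C x y : f (pair2 x y) = - f (pair2 y x).
Proof.
apply/eqP; rewrite -addr_eq0; apply/eqP.
have := alternating2_alt (x + y).
by rewrite alternating2Dl !alternating2Dr !alternating2_alt add0r addr0.
Qed.

End Alternating.

Variables (L : lieAlgType k) (V : lieRep L).

Lemma ce_diff1E (f : ('I_1 -> L) -> V) x y :
  ce_diff f (pair2 x y)
  = act x (f (fun=> y)) - act y (f (fun=> x)) - f (fun=> bracket x y).
Proof.
rewrite /ce_diff !big_ord_recl !big_ord0 /=.
rewrite !(big_mkcond (fun j => _ < _)%N) /= !big_ord_recl !big_ord0 /=.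
rewrite !(addr0, add0r) expr0 expr1 !scaleN1r scale1r.
have -> : pair2 x y \o lift ord0 = fun=> y by rewrite -[LHS]fun1E.
have -> : pair2 x y \o lift (lift ord0 ord0) = fun=> x.
  by rewrite -[LHS]fun1E.
by rewrite -[bracket_args _ _ _]fun1E.
Qed.

Definition triple (x y z : L) : 'I_3 -> L :=
  fun i => nth 0 [:: x; y; z] i.

Lemma tripleE (X : 'I_3 -> L) :
  triple (X ord0) (X (inord 1)) (X ord_max) = X.
Proof.
apply/funext => -[[|[|[|//]]] lt_i]; rewrite /triple /=; congr X;
  by apply: val_inj => //=; rewrite inordK.
Qed.

(** Alternation turns the six signed terms of the differential into two cyclic sums, the form in
    which they appear in a Jacobi identity. *)
Lemma ce_diff2E (f : ('I_2 -> L) -> V) (altf : alternating f) (x y z : L)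
    (X := triple x y z) :
  ce_diff f X
  = act x (f (pair2 y z)) + act y (f (pair2 z x)) + act z (f (pair2 x y))
    + (f (pair2 x (bracket y z)) + f (pair2 y (bracket z x))
       + f (pair2 z (bracket x y))).
Proof.
have P (g : 'I_2 -> L) a b : g ord0 = a -> g ord_max = b -> g = pair2 a b.
  by move=> <- <-; rewrite pair2E.
rewrite /ce_diff !big_ord_recl !big_ord0 /=.
rewrite !(big_mkcond (fun j => _ < _)%N) /= !big_ord_recl !big_ord0 /=.
rewrite !(addr0, add0r) /bump /= ?(addn0, add0n).
rewrite expr0 !expr1 !exprS expr0 !mulN1r ?opprK !scaleN1r !scale1r.
(* These are the six terms with the order and signs of the definition of [ce_diff]. *)
transitivity (act x (f (pair2 y z))
  + (- act y (f (pair2 x z)) + act z (f (pair2 x y)))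
  + (- f (pair2 (bracket x y) z) + f (pair2 (bracket x z) y)
     - f (pair2 (bracket y z) x))).
  congr (_ + (- _ + _) + (- _ + _ - _)).
  - by congr (act _ (f _)); apply: P.
  - by congr (act _ (f _)); apply: P.
  - by congr (act _ (f _)); apply: P.
  - by congr (f _); apply: P; rewrite /bracket_args /X /triple //= inordK.
  - by congr (f _); apply: P; rewrite /bracket_args /X /triple //= inordK.
  - by congr (f _); apply: P; rewrite /bracket_args /X /triple //= inordK.
rewrite (alternating2C altf z x) (alternating2C altf x (bracket _ _)).
rewrite (alternating2C altf y (bracket _ _)).
rewrite (alternating2C altf z (bracket _ _)) (bracketC z x) !actNr.
rewrite (alternating2Nl altf); zmod_cancel.
Qed.

End SmallCochains.

(** * Twisted products and homomorphisms between them *)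

Section Twisted.
Variables (k : fieldType) (L : lieAlgType k) (V : lieRep L).

(* The product of V and L with bracket twisted by f. The type carries the    *)
(* cocycle proofs so that its Lie algebra structure can be inferred.          *)
Definition twisted (f : ('I_2 -> L) -> V)
  & alternating f & ce_diff f = 0 : Type := (V * L)%type.

Variables (f : ('I_2 -> L) -> V) (altf : alternating f) (cycf : ce_diff f = 0).

Local Notation T := (twisted altf cycf).

HB.instance Definition _ := GRing.Lmodule.copy T (V * L)%type.

Let twisted_bracket (a b : T) : T :=
  (act a.2 b.1 - act b.2 a.1 + f (pair2 a.2 b.2), bracket a.2 b.2).

Let twisted_linearr a : linear (twisted_bracket a).
Proof.
move=> c u v; congr pair; last exact: bracket_linearr.
rewrite act_linearr act_linearl (alternating2_linearr altf) /=.
by rewrite !scalerDr scalerN; zmod_cancel.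
Qed.

Let twisted_alt a : twisted_bracket a a = 0.
Proof.
by congr pair; rewrite ?bracket_alt // (alternating2_alt altf) addr0 subrr.
Qed.

Let twisted_linearl b : linear (twisted_bracket^~ b).
Proof.
move=> c u v; congr pair; last exact: (bracket_linearl b.2).
rewrite act_linearr (act_linearl b.1) (alternating2_linearl altf) /=.
by rewrite !scalerDr scalerN; zmod_cancel.
Qed.

(** In the first component the terms in [a.1], [b.1], [c.1] cancel by [act_bracket]; the rest is
    [ce_diff f] at [a.2], [b.2], [c.2]. *)
Let twisted_jacobi a b c :
  twisted_bracket a (twisted_bracket b c)
    + twisted_bracket b (twisted_bracket c a)
    + twisted_bracket c (twisted_bracket a b) = 0.
Proof.
congr pair; last exact: bracket_jacobi.
have := ce_diff2E altf a.2 b.2 c.2; rewrite cycf => /esym cyc.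
rewrite -[RHS]cyc /= !(actDr, actNr, act_bracket).
zmod_cancel.
Qed.

HB.instance Definition _ := isLieAlgebra.Build k T
  twisted_linearl twisted_linearr twisted_alt twisted_jacobi.

Lemma twisted_bracketE (a b : T) :
  bracket a b
  = (act a.2 b.1 - act b.2 a.1 + f (pair2 a.2 b.2), bracket a.2 b.2) :> T.
Proof. by []. Qed.

Let incl (v : zeroLie V) : T := (v, 0).

Let incl_linear : linear incl.
Proof.
by move=> a u v; congr pair; apply/esym; rewrite [LHS]addr0; apply: scaler0.
Qed.

Let incl_bracket u v :
  mkLinear incl_linear (bracket u v)
  = bracket (mkLinear incl_linear u) (mkLinear incl_linear v).
Proof.
rewrite twisted_bracketE /= bracket_alt (alternating2_alt altf).
by rewrite !(linear_zero (act_linearl _)) subrr addr0.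
Qed.

Definition twisted_incl : lieHom (zeroLie V) T := LieHom incl_bracket.

Let proj (a : T) : L := a.2.

Let proj_linear : linear proj. Proof. by []. Qed.

Let proj_bracket a b :
  mkLinear proj_linear (bracket a b)
  = bracket (mkLinear proj_linear a) (mkLinear proj_linear b).
Proof. by []. Qed.

Definition twisted_proj : lieHom T L := LieHom proj_bracket.

Lemma twisted_exact : short_exact twisted_incl twisted_proj.
Proof.
split=> [u v [] // | |].
  by apply/seteqP; split=> // x _; exists ((0, x) : T).
apply/seteqP; split=> [_ [v _ <-] // | [v x] /= x0].
by exists v => //; congr pair; apply: esym.
Qed.

(** The kernel is an abelian ideal, so the [V]-component of [s x] does not contribute to the
    bracket. *)
Lemma twisted_act (s : L -> T) (sK : cancel s twisted_proj) x v :
  twisted_incl (act x v) = bracket (s x) (twisted_incl v).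
Proof.
have sx : (s x).2 = x := sK x.
rewrite twisted_bracketE sx /=.
rewrite (linear_zero (bracket_linearr x)) (alternating20r altf) addr0.
by rewrite (linear_zero (act_linearl _)) subr0.
Qed.

End Twisted.

Section TwistedMap.
Variables (k : fieldType) (L M : lieAlgType k) (phi : lieHom L M).
Variables (V : lieRep L) (W : lieRep M) (psi : {linear V -> W}).
Hypothesis psiP : forall x v, psi (act x v) = act (phi x) (psi v).
Variables (f : ('I_2 -> L) -> V) (altf : alternating f) (cycf : ce_diff f = 0).
Variables (g : ('I_2 -> M) -> W) (altg : alternating g) (cycg : ce_diff g = 0).
Variables (e : L -> W) (le : linear e).
Hypothesis compat : forall x y,
  psi (f (pair2 x y)) + e (bracket x y)
  = act (phi x) (e y) - act (phi y) (e x) + g (pair2 (phi x) (phi y)).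

Let tmap (a : twisted altf cycf) : twisted altg cycg :=
  (psi a.1 + e a.2, phi a.2).

Let tmap_linear : linear tmap.
Proof.
move=> c u v; congr pair; last exact: linearP.
by rewrite /= linearP le scalerDr addrACA.
Qed.

Let tmap_bracket a b :
  mkLinear tmap_linear (bracket a b)
  = bracket (mkLinear tmap_linear a) (mkLinear tmap_linear b).
Proof.
rewrite [RHS]twisted_bracketE; congr pair; last exact: lieHomP.
rewrite /= linearD linearB /= !psiP -addrA compat !actDr.
zmod_cancel.
Qed.

(** [compat] says that [tmap] preserves brackets. This serves twice: with [e] the third component of
    a cocycle it gives the structure map of an extension, and with [phi] and [psi] identities it
    gives a shear between two twisted products. *)
Definition twisted_map : lieHom (twisted altf cycf) (twisted altg cycg) :=
  LieHom tmap_bracket.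

End TwistedMap.

(** * The cocycle of a section of an extension *)

Section SectionCocycle.
Variables (k : fieldType) (L E : lieAlgType k) (V : lieRep L).
Variables (i : lieHom (zeroLie V) E) (p : lieHom E L) (ex : short_exact i p).
Variables (s : {linear L -> E}) (sK : cancel s p).
Hypothesis actP : forall x (v : V), i (act x v) = bracket (s x) (i v).

(** A mere function inverting [i] on the kernel of [p], with default value 0 elsewhere. Identities
    between its values are checked after applying the injective [i]. *)
Lemma exact_ker_lift :
  exists r : E -> zeroLie V, forall e, p e = 0 -> i (r e) = e.
Proof.
have [_ _ kerE] := ex.
suff /choice [r rP] : forall e, exists v, p e = 0 -> i v = e by exists r.
move=> e; have [pe|npe] := pselect (p e = 0); last by exists 0.
have [v _ <-] : range i e by rewrite kerE.
by exists v.
Qed.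

Lemma exact_proj_incl v : p (i v) = 0.
Proof.
have [_ _ kerE] := ex.
have : range i (i v) by exists v.
by rewrite kerE.
Qed.

Lemma exact_incl_bracket u v : bracket (i u) (i v) = 0.
Proof. by rewrite -lieHomP linear0. Qed.

(** The defect of [s] lies in the kernel of [p], hence comes from [V]. Its differential vanishes by
    the Jacobi identities of [E] and of [L], the latter transported by [s]. *)
Lemma section_cocycle :
  exists f : ('I_2 -> L) -> V, [/\ alternating f, ce_diff f = 0 &
    forall x y, i (f (pair2 x y)) = bracket (s x) (s y) - s (bracket x y)].
Proof.
have [inji _ _] := ex.
have [r rP] := exact_ker_lift.
pose b x y := bracket (s x) (s y) - s (bracket x y).
pose f (x : 'I_2 -> L) : V := r (b (x ord0) (x ord_max)).
have iE x y : i (r (b x y)) = b x y.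
  by apply: rP; rewrite linearB /= lieHomP !sK subrr.
have bl y : linear (fun x => b x y).
  move=> a u v; rewrite /b linearP bracket_linearl (bracket_linearl y).
  rewrite linearP /= scalerBr; zmod_cancel.
have br x : linear (b x).
  move=> a u v; rewrite /b linearP bracket_linearr (bracket_linearr x).
  rewrite linearP /= scalerBr; zmod_cancel.
have altf : alternating f.
  apply: (@bilinear_alternating2 k L V (fun x y => r (b x y))).
  - by move=> y a u v; apply: inji; rewrite linearP !iE bl.
  - by move=> x a u v; apply: inji; rewrite linearP !iE br.
  - move=> x; apply: inji; rewrite iE linear0 /b !bracket_alt linear0.
    exact: subrr.
exists f; split => //.
apply/funext => X; rewrite -[X]tripleE (ce_diff2E altf).
move: (X ord0) (X (inord 1)) (X ord_max) => x y z.
apply: inji; rewrite !linearD !actP /f /= !iE /b linear0.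
rewrite !bracketDr !bracketNr.
have /(congr1 s) := bracket_jacobi x y z; rewrite !linearD linear0 /= => J.
have {}J : s (bracket x (bracket y z)) = - s (bracket y (bracket z x))
   - s (bracket z (bracket x y)).
  by apply/eqP; rewrite -subr_eq0 opprB opprK addrA addrAC J.
rewrite J -[RHS](bracket_jacobi (s x) (s y) (s z)).
zmod_cancel.
Qed.

Variables (f : ('I_2 -> L) -> V) (altf : alternating f) (cycf : ce_diff f = 0).
Hypothesis fE :
  forall x y, i (f (pair2 x y)) = bracket (s x) (s y) - s (bracket x y).

Let smap (a : twisted altf cycf) : E := i a.1 + s a.2.

Let smap_linear : linear smap.
Proof. by move=> c u v; rewrite /smap !linearP scalerDr addrACA. Qed.

Let smap_bracket a b :
  mkLinear smap_linear (bracket a b)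
  = bracket (mkLinear smap_linear a) (mkLinear smap_linear b).
Proof.
rewrite /= /smap /= linearD linearB !actP fE bracketDl !bracketDr.
rewrite exact_incl_bracket (bracketC (i a.1)); zmod_cancel.
Qed.

Definition section_map : lieHom (twisted altf cycf) E := LieHom smap_bracket.

Lemma section_mapE a : section_map a = i a.1 + s a.2.
Proof. by []. Qed.

Lemma section_map_proj a : p (section_map a) = a.2.
Proof. by rewrite linearD exact_proj_incl sK add0r. Qed.

(** Each [e] is uniquely the sum of the kernel element [e - s (p e)] and of [s (p e)]. *)
Lemma section_map_bij : bijective section_map.
Proof.
have [inji _ _] := ex.
have [r rP] := exact_ker_lift.
exists (fun e => (r (e - s (p e)), p e)) => [a | e].
  rewrite section_map_proj; case: a => v x /=; congr pair.
  apply: inji; rewrite /smap /= addrK rP //.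
  exact: exact_proj_incl.
rewrite /= /smap /= rP ?subrK // linearB /= sK.
exact: subrr.
Qed.

End SectionCocycle.

(** * From cocycles to extensions *)

Section Classification.
Variables (k : fieldType) (G : morLie k) (R : morRep G).
Implicit Types c : cocycle2 R.

Lemma cocycle2_cochain c : cochain (cocycle2_val c).
Proof. by case: c => c cP; case/asboolP: (cP). Qed.

Lemma cocycle2_diff c : mLA_diff (cocycle2_val c) = 0.
Proof. by case: c => c cP; case/asboolP: (cP). Qed.

Lemma cocycle2_alt_dom c : alternating (cocycle2_val c).1.1.
Proof. by case: (cocycle2_cochain c). Qed.

Lemma cocycle2_alt_cod c : alternating (cocycle2_val c).1.2.
Proof. by case: (cocycle2_cochain c). Qed.

Lemma cocycle2_diff_dom c : ce_diff (cocycle2_val c).1.1 = 0.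
Proof. exact: (congr1 (fun d => d.1.1) (cocycle2_diff c)). Qed.

Lemma cocycle2_diff_cod c : ce_diff (cocycle2_val c).1.2 = 0.
Proof. exact: (congr1 (fun d => d.1.2) (cocycle2_diff c)). Qed.

Lemma mLA_diff1_cross (c : precochain R 1) x y :
  (mLA_diff c).2 (pair2 x y)
  = rmap R (c.1.1 (pair2 x y)) - c.1.2 (pair2 (mmap G x) (mmap G y))
    - (act (mmap G x) (c.2 (fun=> y)) - act (mmap G y) (c.2 (fun=> x))
       - c.2 (fun=> bracket x y)).
Proof.
by rewrite /mLA_diff /= ce_diff1E -[_ \o _]pair2E.
Qed.

Definition cross c (x : mdom G) : rcod R := (cocycle2_val c).2 (fun=> x).

Lemma cross_linear c : linear (cross c).
Proof. by apply: alternating1_linear; case: (cocycle2_cochain c). Qed.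

(** The vanishing of the third component of [mLA_diff c], arranged as the hypothesis [compat] of
    [twisted_map]. *)
Lemma cocycle2_compat c x y :
  rmap R ((cocycle2_val c).1.1 (pair2 x y)) + cross c (bracket x y)
  = act (mmap G x) (cross c y) - act (mmap G y) (cross c x)
    + (cocycle2_val c).1.2 (pair2 (mmap G x) (mmap G y)).
Proof.
have := mLA_diff1_cross (cocycle2_val c) x y.
rewrite cocycle2_diff => /esym/eqP; rewrite subr_eq0 subr_eq => /eqP E.
by rewrite E -/(cross c _); zmod_cancel.
Qed.

Lemma cocycle2_intro (c : precochain R 1) :
  cochain c -> ce_diff c.1.1 = 0 -> ce_diff c.1.2 = 0 ->
  (forall x y,
    rmap R (c.1.1 (pair2 x y)) + c.2 (fun=> bracket x y)
    = act (mmap G x) (c.2 (fun=> y)) - act (mmap G y) (c.2 (fun=> x))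
      + c.1.2 (pair2 (mmap G x) (mmap G y))) ->
  c \in @cocycle k G R 1.
Proof.
move=> cc c1 c2 c3; apply/asboolP; split=> //.
congr (_, _, _) => //; apply/funext => X; rewrite -[X]pair2E.
move: (X ord0) (X ord_max) => x y.
apply: etrans (mLA_diff1_cross c x y) _.
move/eqP: (c3 x y); rewrite -subr_eq => /eqP <-.
zmod_cancel.
Qed.

Section CocycleExt.
Variable c : cocycle2 R.

Let mapP := twisted_map (@morRepP _ _ R) (cocycle2_alt_dom c)
  (cocycle2_diff_dom c) (cocycle2_alt_cod c) (cocycle2_diff_cod c)
  (cross_linear c) (cocycle2_compat c).

Definition cocycle_mor : morLie k := MorLie mapP.

Let inclP (v : zeroLie (rdom R)) :
  mmap cocycle_mor (twisted_incl (cocycle2_alt_dom c) (cocycle2_diff_dom c) v)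
  = twisted_incl (cocycle2_alt_cod c) (cocycle2_diff_cod c)
      (mmap (zeroMor (rmap R)) v).
Proof.
congr pair; last exact: linear0.
by rewrite /= (linear_zero (cross_linear c)) addr0.
Qed.

Let projP a :
  mmap G (twisted_proj (cocycle2_alt_dom c) (cocycle2_diff_dom c) a)
  = twisted_proj (cocycle2_alt_cod c) (cocycle2_diff_cod c)
      (mmap cocycle_mor a).
Proof. by []. Qed.

Definition cocycle_ext : abExt G (rmap R) :=
  @AbExt k G _ _ _ cocycle_mor
    (@MorHom k (zeroMor (rmap R)) cocycle_mor _ _ inclP)
    (@MorHom k cocycle_mor G _ _ projP)
    (twisted_exact _ _) (twisted_exact _ _).

Lemma cocycle_ext_induced : induced_rep cocycle_ext.
Proof.
move=> s; split=> x v.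
  exact: (twisted_act (altf := cocycle2_alt_dom c) (sec_domK s) x v).
exact: (twisted_act (altf := cocycle2_alt_cod c) (sec_codK s) x v).
Qed.

End CocycleExt.

(** * Isomorphism of extensions is an equivalence relation *)

Lemma abExt_iso_sym (E E' : abExt G (rmap R)) :
  abExt_iso E E' -> abExt_iso E' E.
Proof.
move=> [F [[a' aK a'K] [b' bK b'K]] [F1 F2 F3 F4]].
have la : linear a'.
  by move=> c u v; apply: (can_inj aK); rewrite a'K linearP !a'K.
have lb : linear b'.
  by move=> c u v; apply: (can_inj bK); rewrite b'K linearP !b'K.
have ha u v : mkLinear la (bracket u v)
    = bracket (mkLinear la u) (mkLinear la v).
  by apply: (can_inj aK); rewrite /= lieHomP !a'K.
have hb u v : mkLinear lb (bracket u v)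
    = bracket (mkLinear lb u) (mkLinear lb v).
  by apply: (can_inj bK); rewrite /= lieHomP !b'K.
have hF x : mmap E (LieHom ha x) = LieHom hb (mmap E' x).
  by apply: (can_inj bK); rewrite /= b'K -morHomP a'K.
exists (MorHom hF) => /=; first by split; [exists (hdom F) | exists (hcod F)].
split=> [v | x | w | y].
- by apply: (can_inj aK); rewrite /= a'K F1.
- by rewrite /= -F2 a'K.
- by apply: (can_inj bK); rewrite /= b'K F3.
- by rewrite /= -F4 b'K.
Qed.

Lemma abExt_iso_trans (E1 E2 E3 : abExt G (rmap R)) :
  abExt_iso E1 E2 -> abExt_iso E2 E3 -> abExt_iso E1 E3.
Proof.
move=> [F [Fa Fb] [F1 F2 F3 F4]] [H [Ha Hb] [H1 H2 H3 H4]].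
have la : linear (hdom H \o hdom F) by move=> c u v; rewrite /= !linearP.
have lb : linear (hcod H \o hcod F) by move=> c u v; rewrite /= !linearP.
have ha u v : mkLinear la (bracket u v)
    = bracket (mkLinear la u) (mkLinear la v).
  by rewrite /= !lieHomP.
have hb u v : mkLinear lb (bracket u v)
    = bracket (mkLinear lb u) (mkLinear lb v).
  by rewrite /= !lieHomP.
have hF x : mmap E3 (LieHom ha x) = LieHom hb (mmap E1 x).
  by rewrite /= !morHomP.
exists (MorHom hF) => /=; first by split; apply: bij_comp.
split=> [v | x | w | y] /=.
- by rewrite F1 H1.
- by rewrite H2 F2.
- by rewrite F3 H3.
- by rewrite H4 F4.
Qed.

Lemma abExt_iso_refl (E : abExt G (rmap R)) : abExt_iso E E.
Proof.
have la : linear (@id (mdom E)) by [].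
have lb : linear (@id (mcod E)) by [].
have ha u v : mkLinear la (bracket u v)
    = bracket (mkLinear la u) (mkLinear la v) by [].
have hb u v : mkLinear lb (bracket u v)
    = bracket (mkLinear lb u) (mkLinear lb v) by [].
have hF x : mmap E (LieHom ha x) = LieHom hb (mmap E x) by [].
by exists (MorHom hF) => //=; split; exists id.
Qed.

Lemma abExt_section_ex (E : abExt G (rmap R)) : inhabited (abExt_section E).
Proof.
have [_ ra _] := ext_exact_dom E; have [_ rb _] := ext_exact_cod E.
have [s sK] := split_epi ra; have [t tK] := split_epi rb.
by split; exists s t.
Qed.

(* This says both that c - c' is the coboundary of (d, e, 0) and that         *)
(* (v, x) |-> (v + d x, x) and (w, y) |-> (w + e y, y) form a morphism from   *)
(* the extension twisted by c to the one twisted by c'.                       *)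
Definition cohomologous_by c c' (d : mdom G -> rdom R) (e : mcod G -> rcod R) :=
  [/\ linear d, linear e &
  [/\ forall x y, (cocycle2_val c).1.1 (pair2 x y) + d (bracket x y)
        = act x (d y) - act y (d x) + (cocycle2_val c').1.1 (pair2 x y),
      forall x y, (cocycle2_val c).1.2 (pair2 x y) + e (bracket x y)
        = act x (e y) - act y (e x) + (cocycle2_val c').1.2 (pair2 x y) &
      forall x, rmap R (d x) + cross c' x = cross c x + e (mmap G x)]].

Lemma simple_coboundary2P c c' :
  c - c' \in @simple_coboundary2 k G R <->
  exists d e, cohomologous_by c c' d e.
Proof.
have subE : cocycle2_val (c - c') = cocycle2_val c - cocycle2_val c' :=
  raddfB (val : cocycle2 R -> _) c c'.
(* The zero 0-cochain contributes nothing, so the third component of the coboundary of [(d, e, 0)]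
   is [psi d - e phi]. *)
have ce0 : @ce_diff k (mdom G) (pullRep (mmap G) (rcod R)) 0 0 = 0.
  exact: (linear_zero (@ce_diff_linear k 0 _ (pullRep (mmap G) (rcod R)))).
split=> [/asboolP[d [e [[/= altd alte _]]]] | [d [e [ld le [dP eP crossP]]]]].
  move=> dE; have {}dE := etrans dE subE.
  exists (fun x => d (fun=> x)), (fun y => e (fun=> y)).
  split; [exact: alternating1_linear | exact: alternating1_linear |].
  split=> [x y | x y | x].
  - have := congr1 (fun z : precochain R 1 => z.1.1 (pair2 x y)) dE.
    rewrite /= ce_diff1E => /eqP; rewrite eq_sym subr_eq => /eqP ->.
    zmod_cancel.
  - have := congr1 (fun z : precochain R 1 => z.1.2 (pair2 x y)) dE.
    rewrite /= ce_diff1E => /eqP; rewrite eq_sym subr_eq => /eqP ->.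
    zmod_cancel.
  - have := congr1 (fun z : precochain R 1 => z.2 (fun=> x)) dE.
    rewrite /= ce0 subr0 => /eqP; rewrite eq_sym subr_eq => /eqP E.
    rewrite /cross E.
    zmod_cancel.
apply/asboolP; exists (fun x => d (x ord0)), (fun y => e (y ord0)); split.
  split; [exact: linear_alternating1 | exact: linear_alternating1 |].
  exact: alternating0.
apply: etrans (esym subE); congr (_, _, _); apply/funext => x.
- rewrite -[x]pair2E ce_diff1E; apply/eqP; rewrite eq_sym subr_eq; apply/eqP.
  move: (dP (x ord0) (x ord_max)) => /eqP.
  rewrite eq_sym -subr_eq => /eqP <-; zmod_cancel.
- rewrite -[x]pair2E ce_diff1E; apply/eqP; rewrite eq_sym subr_eq; apply/eqP.
  move: (eP (x ord0) (x ord_max)) => /eqP.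
  rewrite eq_sym -subr_eq => /eqP <-; zmod_cancel.
- rewrite /= ce0 -[x]fun1E.
  move: (crossP (x ord0)) => /eqP; rewrite eq_sym -subr_eq => /eqP.
  by rewrite /cross => <-; zmod_cancel.
Qed.

(** Compatibility with inclusions and projections forces the shear form; evaluating the homomorphism
    laws at elements [(0, x)] then gives the equations of [cohomologous_by]. Conversely these
    equations make the shears homomorphisms, with inverses obtained by subtracting [d] and [e]. *)
Lemma cocycle_ext_isoP c c' :
  abExt_iso (cocycle_ext c) (cocycle_ext c') <->
  exists d e, cohomologous_by c c' d e.
Proof.
split=> [[F _ [F1 F2 F3 F4]] | [d [e [ld le [dP eP crossP]]]]].
  pose d (x : mdom G) : rdom R := (hdom F (0, x)).1.
  pose e (y : mcod G) : rcod R := (hcod F (0, y)).1.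
  have FdE v x : hdom F (v, x) = (v + d x, x).
    have -> : (v, x) = hdom (ext_incl (cocycle_ext c)) v + (0, x).
      by congr pair; apply/esym; [exact: addr0 | exact: add0r].
    rewrite linearD F1 /d; have := F2 (0, x).
    case: (hdom F (0, x)) => u z /= zE.
    by congr pair; rewrite -[RHS]zE; exact: add0r.
  have FcE w y : hcod F (w, y) = (w + e y, y).
    have -> : (w, y) = hcod (ext_incl (cocycle_ext c)) w + (0, y).
      by congr pair; apply/esym; [exact: addr0 | exact: add0r].
    rewrite linearD F3 /e; have := F4 (0, y).
    case: (hcod F (0, y)) => u z /= zE.
    by congr pair; rewrite -[RHS]zE; exact: add0r.
  exists d, e; split.
  - move=> a x y.
    have := linearP (hdom F) a (0, x) (0, y).
    have -> : a *: (0, x) + (0, y) = (0, a *: x + y) :> mdom (cocycle_ext c).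
      by congr pair => //; rewrite [LHS]addr0; apply: scaler0.
    rewrite !FdE => /(congr1 fst) /=.
    by rewrite !add0r.
  - move=> a x y.
    have := linearP (hcod F) a (0, x) (0, y).
    have -> : a *: (0, x) + (0, y) = (0, a *: x + y) :> mcod (cocycle_ext c).
      by congr pair => //; rewrite [LHS]addr0; apply: scaler0.
    rewrite !FcE => /(congr1 fst) /=.
    by rewrite !add0r.
  split=> [x y | x y | x].
  - have := lieHomP (hdom F) (0, x) (0, y).
    rewrite !FdE /= => /(congr1 fst) /=.
    by rewrite !act0r subr0 !add0r.
  - have := lieHomP (hcod F) (0, x) (0, y).
    rewrite !FcE /= => /(congr1 fst) /=.
    by rewrite !act0r subr0 !add0r.
  - have := morHomP F (0, x).
    rewrite FdE /= FcE => /(congr1 fst) /=.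
    by rewrite linear0 !add0r.
have idP (L : lieAlgType k) (x y : L) :
  (idfun : {linear L -> L}) (bracket x y) = bracket x y by [].
pose a : lieHom (mdom (cocycle_ext c)) (mdom (cocycle_ext c')) :=
  twisted_map (phi := LieHom (idP (mdom G))) (psi := idfun)
   (fun _ _ => erefl) (cocycle2_alt_dom c) (cocycle2_diff_dom c)
   (cocycle2_alt_dom c') (cocycle2_diff_dom c') ld dP.
pose b : lieHom (mcod (cocycle_ext c)) (mcod (cocycle_ext c')) :=
  twisted_map (phi := LieHom (idP (mcod G))) (psi := idfun)
   (fun _ _ => erefl) (cocycle2_alt_cod c) (cocycle2_diff_cod c)
   (cocycle2_alt_cod c') (cocycle2_diff_cod c') le eP.
have abP x : mmap (cocycle_ext c') (a x) = b (mmap (cocycle_ext c) x).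
  (* Commuting with the structure maps is the third equation, [crossP]. *)
  by congr pair; rewrite /= linearD -addrA crossP addrA.
exists (MorHom abP).
  split.
    exists (fun x => (x.1 - d x.2, x.2)) => -[v x].
      by congr pair; rewrite addrK.
    by congr pair; rewrite subrK.
  exists (fun x => (x.1 - e x.2, x.2)) => -[v x].
    by congr pair; rewrite addrK.
  by congr pair; rewrite subrK.
split=> // v; congr pair.
  by rewrite /= (linear_zero ld) addr0.
by rewrite /= (linear_zero le) addr0.
Qed.

(** The sections give a cocycle, and the two maps [section_map] carry its twisted extension onto
    [E]. *)
Lemma cocycle_ext_surj (E : abExt G (rmap R)) :
  induced_rep E -> exists c, abExt_iso (cocycle_ext c) E.
Proof.
move=> indE.
have [s] := abExt_section_ex E; have [actd actc] := indE s.
have exd := ext_exact_dom E; have exc := ext_exact_cod E.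
have sdK := sec_domK s; have scK := sec_codK s.
have [f [altf cycf fE]] := section_cocycle exd sdK actd.
have [g [altg cycg gE]] := section_cocycle exc scK actc.
have [injd _ _] := exd; have [injc _ _] := exc.
have [r rP] := exact_ker_lift exc.
(* The two lifts of [mmap G x] to [mcod E] differ by an element of the kernel, so the default value
   of [r] does not occur. *)
pose e : mdom G -> rcod R :=
  fun x => r (mmap E (sec_dom s x) - sec_cod s (mmap G x)).
have eE x : hcod (ext_incl E) (e x)
    = mmap E (sec_dom s x) - sec_cod s (mmap G x).
  by apply: rP; rewrite linearB /= -morHomP sdK scK subrr.
have le : linear e.
  move=> a u v; apply: injc; rewrite linearP !eE.
  rewrite (linearP (sec_dom s)) (linearP (mmap E)).
  rewrite (linearP (mmap G)) (linearP (sec_cod s)) scalerBr.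
  zmod_cancel.
have cP : ((f, g, fun x => e (x ord0)) : precochain R 1) \in @cocycle k G R 1.
  apply: cocycle2_intro => //=.
    split; [exact: altf | exact: altg | exact: (linear_alternating1 le)].
  move=> x y; apply: injc.
  rewrite !linearD linearN -(morHomP (ext_incl E) (f _)) fE gE !actc !eE.
  rewrite linearB !lieHomP !(bracketDl, bracketDr, bracketNl, bracketNr).
  rewrite !(bracketC (sec_cod s (mmap G y))).
  (* The only nonlinear terms left are those of [i (e x), i (e y)] = 0.       *)
  have := exact_incl_bracket (hcod (ext_incl E)) (e x) (e y).
  rewrite !eE !(bracketDl, bracketDr, bracketNl, bracketNr) => ab.
  apply/eqP; rewrite -subr_eq0 -[X in _ == X]ab; apply/eqP.
  zmod_cancel.
exists (Cocycle2 cP).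
set c := Cocycle2 cP.
pose md : lieHom (mdom (cocycle_ext c)) (mdom E) :=
  section_map actd (cocycle2_alt_dom c) (cocycle2_diff_dom c) fE.
pose mc : lieHom (mcod (cocycle_ext c)) (mcod E) :=
  section_map actc (cocycle2_alt_cod c) (cocycle2_diff_cod c) gE.
have hM a : mmap E (md a) = mc (mmap (cocycle_ext c) a).
  rewrite /md /mc !section_mapE /= /cross linearD (morHomP (ext_incl E)).
  by rewrite linearD eE -addrA subrK.
exists (MorHom hM).
  split; first exact: (section_map_bij exd sdK).
  exact: (section_map_bij exc scK).
split=> [v | x | w | y].
- by rewrite /= linear0 addr0.
- exact: (section_map_proj exd sdK).
- by rewrite /= linear0 addr0.
- exact: (section_map_proj exc scK).
Qed.

(** * Isomorphism classes and the bijection *)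

Lemma abExt_class_eq (E E' : abExt G (rmap R)) :
  abExt_iso E E' -> abExt_class E = abExt_class E'.
Proof.
move=> EE'; apply: funext => E''.
apply: propext; split=> -[ind iso]; split=> //.
  by apply: abExt_iso_trans iso; apply: abExt_iso_sym.
exact: abExt_iso_trans iso.
Qed.

Definition cocycle_class c : Ext R :=
  MkExt (ex_intro2 _ _ (cocycle_ext c) (cocycle_ext_induced (c := c)) erefl).

Lemma cocycle_classP c c' :
  cocycle_class c = cocycle_class c'
  <-> c - c' \in @simple_coboundary2 k G R.
Proof.
split=> [E | sub].
  apply/simple_coboundary2P/cocycle_ext_isoP.
  (* Equal classes have the same members, and [cocycle_ext c'] belongs to its own class. *)
  have : in_class (cocycle_class c') (cocycle_ext c').
    by split; [exact: cocycle_ext_induced | exact: abExt_iso_refl].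
  by rewrite -E => -[].
by apply/Ext_eq/abExt_class_eq/cocycle_ext_isoP/simple_coboundary2P.
Qed.

Lemma cocycle_class_surj (C : Ext R) : exists c, C = cocycle_class c.
Proof.
have [E indE CE] := in_classP C.
have [c cE] := cocycle_ext_surj indE.
by exists c; apply: Ext_eq; rewrite CE -(abExt_class_eq cE).
Qed.

End Classification.

Theorem theorem5p2 (k : fieldType) (char0 : [pchar k] =i pred0)
    (G : morLie k) (R : morRep G) :
  exists f : Ext R -> simpleH2 R, bijective f.
Proof.
(* A cocycle is chosen in each class. By [cocycle_classP] neither this choice nor that of [repr]
   affects the class of the result, which gives both cancellations. *)
pose cocycle_of C := sval (cid (@cocycle_class_surj k G R C)).
have cocycle_ofK C : cocycle_class (cocycle_of C) = C.
  by rewrite -(svalP (cid (cocycle_class_surj C))).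
exists (fun C => \pi_(simpleH2 R)%qT (cocycle_of C)).
exists (fun q => cocycle_class (repr q)) => [C | q].
  rewrite -[RHS]cocycle_ofK; apply/cocycle_classP.
  by rewrite Quotient.idealrBE reprK.
rewrite -[RHS]reprK; apply/eqP.
by rewrite -Quotient.idealrBE; apply/cocycle_classP.
Qed.
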